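(* Let $A$ be a unital prime $C^*$-algebra and let $a\in A$. The following conditions are equivalent: (1) $a\in A^\wedge$ and $a$ is maximal in $A$ with respect to the diamond partial order $\leq_\diamond$; (2) $a\in A^{-1}_l\cup A^{-1}_r$.
   Context: For elements $a,b$ of a unital $C^*$-algebra $A$, the diamond relation is defined by: $a\leq_\diamond b$ if and only if $aA\subseteq bA$, $Aa\subseteq Ab$ and $aa^*a=ab^*a$; it is a partial order on $A$. $a$ is maximal if $a\leq_\diamond b$ with $b\in A$ implies $a=b$. $A^\wedge$ is the set of (von Neumann) regular elements of $A$, i.e. those $a\in A$ for which there is $c\in A$ with $a=aca$. $A^{-1}_l$ and $A^{-1}_r$ denote the sets of left invertible and right invertible elements of $A$, respectively. *)

(* Defs.v *)
From HB Require Import structures.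
From mathcomp Require Import all_boot all_order all_algebra.
From mathcomp Require Import complex.
From mathcomp Require Import all_classical all_reals all_analysis.

Set Implicit Arguments.
Unset Strict Implicit.
Unset Printing Implicit Defensive.

Import Order.TTheory GRing.Theory Num.Theory.
Import numFieldNormedType.Exports.

Local Open Scope classical_set_scope.
Local Open Scope ring_scope.

(* A structure deriving from both normed modules and rings cannot be declared
   in the current hierarchy, where the least common heir of these two is
   [numDomainType].  The product is therefore part of the mixin, and the
   library's ring and algebra operations are recovered just below.
   The norm takes its values in the nonnegative reals of [R[i]]. *)
HB.mixin Record isCStarAlgebra (R : realType) A
    of CompleteNormedModule R[i] A := {
  cstar_mul : A -> A -> A ;
  cstar_one : A ;
  cstar_mulA : associative cstar_mul ;
  cstar_mul1l : left_id cstar_one cstar_mul ;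
  cstar_mul1r : right_id cstar_one cstar_mul ;
  cstar_mulDl : left_distributive cstar_mul +%R ;
  cstar_mulDr : right_distributive cstar_mul +%R ;
  cstar_one_neq0 : cstar_one != 0 ;
  cstar_scaleAl : forall (c : R[i]) (a b : A),
    c *: cstar_mul a b = cstar_mul (c *: a) b ;
  cstar_scaleAr : forall (c : R[i]) (a b : A),
    c *: cstar_mul a b = cstar_mul a (c *: b) ;
  cstar_normM : forall a b : A, `|cstar_mul a b| <= `|a| * `|b| ;
  star : A -> A ;
  starK : involutive star ;
  starD : {morph star : a b / a + b} ;
  starZ : forall (c : R[i]) (a : A), star (c *: a) = c^* *: star a ;
  star_mul : forall a b : A, star (cstar_mul a b) = cstar_mul (star b) (star a) ;
  cstar_norm_star : forall a : A, `|cstar_mul (star a) a| = `|a| ^+ 2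
}.

#[short(type="cstarAlgType")]
HB.structure Definition CStarAlgebra (R : realType) :=
  { A of isCStarAlgebra R A & CompleteNormedModule R[i] A }.

Section CStarAlgebraRing.
Variables (R : realType) (A : cstarAlgType R).

HB.instance Definition _ := GRing.Zmodule_isNzRing.Build A
  (@cstar_mulA R A) (@cstar_mul1l R A) (@cstar_mul1r R A)
  (@cstar_mulDl R A) (@cstar_mulDr R A) (@cstar_one_neq0 R A).

HB.instance Definition _ :=
  GRing.Lmodule_isLalgebra.Build R[i] A (@cstar_scaleAl R A).

HB.instance Definition _ :=
  GRing.Lalgebra_isAlgebra.Build R[i] A (@cstar_scaleAr R A).

Lemma starM (a b : A) : star (a * b) = star b * star a.
Proof. exact: star_mul. Qed.

Lemma cstar_norm_mul_le (a b : A) : `|a * b| <= `|a| * `|b|.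
Proof. exact: cstar_normM. Qed.

Lemma norm_starM (a : A) : `|star a * a| = `|a| ^+ 2.
Proof. exact: cstar_norm_star. Qed.

End CStarAlgebraRing.

Section DiamondOrder.
Variables (R : realType) (A : cstarAlgType R).
Implicit Types a b : A.

Definition prime_algebra : Prop :=
  forall a b, (forall x : A, a * x * b = 0) -> a = 0 \/ b = 0.

Definition diamond_le a b : Prop :=
  [/\ [set a * x | x in [set: A]] `<=` [set b * x | x in [set: A]],
      [set x * a | x in [set: A]] `<=` [set x * b | x in [set: A]]
    & a * star a * a = a * star b * a].

Definition diamond_maximal a : Prop := forall b, diamond_le a b -> a = b.

Definition regular_elements : set A := [set a | exists c, a = a * c * a].

Definition left_invertible_elements : set A := [set a | exists c, c * a = 1].

Definition right_invertible_elements : set A := [set a | exists c, a * c = 1].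

End DiamondOrder.

Arguments prime_algebra {R} A.
Arguments regular_elements {R} A.
Arguments left_invertible_elements {R} A.
Arguments right_invertible_elements {R} A.

(* Main.v *)
Require Import Defs.
From HB Require Import structures.
From mathcomp Require Import all_boot all_order all_algebra.
From mathcomp Require Import complex.
From mathcomp Require Import all_classical all_reals all_analysis.

(* A left invertible [a] satisfies [star a a z = 0 -> z = 0].  If [a] lies below
   [b], then [a = b x], and cancelling [a] in [a (star a) a = a (star b) a] gives
   [star a b = star a a]; hence [star a a x = star a a], [x = 1] and [a = b].
   The right invertible case follows by applying the involution.
   Conversely, let [a = a c a], let [w] be the self-adjoint projection onto [a A],
   and let [p = 1 - w], [q = 1 - c a].  Every [a + p x q] lies above [a], so
   maximality forces [p A q = 0], and primeness yields [w = 1] or [c a = 1]. *)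

Import Order.TTheory GRing.Theory Num.Theory.
Import numFieldNormedType.Exports.

Local Open Scope classical_set_scope.
Local Open Scope ring_scope.

(** Norms take values in [R[i]], hence the complex form. Being comparable to 0, [q] and [e] are
    real, which leaves geometric decay in [R]. *)
Lemma expr_lt_near_complex (R : realType) (q e : R[i]) :
  0 <= q -> q < 1 -> 0 < e -> \forall n \near \oo, q ^+ n < e.
Proof.
move=> q0 q1 e0.
have [/complex_realP[r qE] /complex_realP[d eE]] :=
  (ger0_real q0, gtr0_real e0).
rewrite {}qE {}eE in q0 q1 e0 *.
move: q0 q1 e0; rewrite -[0]/(0%:C%C) -[1]/(1%:C%C) lecR !ltcR => r0 r1 d0.
have rlt1 : `|r| < 1 by rewrite ger0_norm.
near=> n; rewrite -rmorphXn ltcR; apply: le_lt_trans (ler_norm _) _.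
rewrite -normrN -sub0r; near: n; move: d d0; apply/cvgrPdist_lt.
exact: cvg_expr.
Unshelve. all: by end_near. Qed.

Section CStarFacts.
Context {R : realType} {A : cstarAlgType R}.
Implicit Types a b c e t x : A.

Lemma starN a : star (- a) = - star a.
Proof. by rewrite -scaleN1r starZ rmorphN1 scaleN1r. Qed.

Lemma starB a b : star (a - b) = star a - star b.
Proof. by rewrite starD starN. Qed.

Lemma star1 : star 1 = 1 :> A.
Proof. by have := starM (star 1) (1 : A); rewrite mulr1 starK mulr1. Qed.

Lemma star0 : star 0 = 0 :> A.
Proof. by have := starB 0 0; rewrite !subrr. Qed.

Lemma cstar_norm1 : `|1 : A| = 1.
Proof.
have := norm_starM (1 : A); rewrite star1 mul1r expr2 -[LHS]mulr1 => /esym.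
by apply: mulfI; rewrite normr_eq0 oner_eq0.
Qed.

Lemma cstar_normX x n : `|x ^+ n| <= `|x| ^+ n.
Proof.
elim: n => [|n IHn]; first by rewrite !expr0 cstar_norm1.
by rewrite !exprS (le_trans (cstar_norm_mul_le _ _))// ler_wpM2l.
Qed.

Lemma star_mul_eq0 x : star x * x = 0 -> x = 0.
Proof.
move=> xx0; apply/eqP; rewrite -normr_eq0 -sqrf_eq0 -norm_starM xx0.
by rewrite normr0.
Qed.

Lemma neumann_series_cvg x : `|x| < 1 ->
  cvg ((fun n => \sum_(k < n) x ^+ k) @ \oo).
Proof.
move=> x1; have x1' : 0 < 1 - `|x| by rewrite subr_gt0.
apply/cauchy_cvgP/cauchy_exP => e e0.
(* [N] makes the geometric bound [|x|^N / (1 - |x|)] on the tail smaller than [e]; the partial sum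
   below [N] is the centre that [cauchy_exP] asks for. *)
have /filter_ex[N xN] : \forall n \near \oo, `|x| ^+ n < (1 - `|x|) * e.
  by apply: expr_lt_near_complex => //; apply: mulr_gt0.
exists (\sum_(k < N) x ^+ k); exists N => // n /= Nn.
rewrite -ball_normE /= -(subnKC Nn) big_split_ord /= opprD addrA subrr sub0r normrN.
rewrite -(ltr_pM2l x1'); apply: le_lt_trans xN.
have xS : `|\sum_(k < n - N) x ^+ (N + k)| <=
    `|x| ^+ N * \sum_(k < n - N) `|x| ^+ k.
  rewrite mulr_sumr; apply: le_trans (ler_norm_sum _ _ _) _.
  by apply: ler_sum => k _; rewrite -exprD cstar_normX.
apply: le_trans (ler_wpM2l (ltW x1') xS) _.
(* [(1 - |x|)] times the geometric sum telescopes to [1 - |x|^(n - N)], which is at most 1. *)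
rewrite mulrCA -[leRHS]mulr1; apply: ler_wpM2l; first exact: exprn_ge0.
by rewrite -opprB mulNr -subrX1 opprB lerBlDr lerDl exprn_ge0.
Qed.

(** The limit [y] of the Neumann series works: with [S] its partial sum below [n],
    [(1 - x) y - 1 = (1 - x) (y - S) - x^n], and both terms are eventually below [e / 2]. *)
Lemma right_invertible_1B x : `|x| < 1 -> exists y, (1 - x) * y = 1.
Proof.
move=> x1; have /cvg_ex[y xy] := neumann_series_cvg x x1.
exists y; apply/eqP; rewrite -subr_eq0 -normr_le0.
apply/ler_addgt0Pl => e e0; rewrite addr0.
have e2 : 0 < e / 2 by rewrite divr_gt0.
have x2 : 0 < 1 + `|1 - x| by rewrite ltr_wpDr.
have [n [xn yn]] : exists n, `|x| ^+ n < e / 2 /\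
    `|y - \sum_(k < n) x ^+ k| < e / 2 / (1 + `|1 - x|).
  apply: (@filter_ex _ \oo).
  apply: filterI; first exact: expr_lt_near_complex.
  by move/cvgrPdist_lt: xy; apply; apply: divr_gt0.
have xS : (1 - x) * \sum_(k < n) x ^+ k = 1 - x ^+ n.
  by rewrite -[RHS]opprB subrX1 -mulNr opprB.
have -> : (1 - x) * y - 1 = (1 - x) * (y - \sum_(k < n) x ^+ k) - x ^+ n.
  by rewrite mulrBr xS opprB addrA addrAC addrK.
rewrite [e]splitr; apply: le_trans (ler_normB _ _) (lerD _ _).
  apply: le_trans (cstar_norm_mul_le _ _) _.
  move: yn; rewrite ltr_pdivlMr// => /ltW; apply: le_trans.
  by rewrite mulrC ler_wpM2l// lerDr.
exact: le_trans (cstar_normX _ _) (ltW xn).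
Qed.

(* For [s] real, the C*-identity gives [|s - t|^2 = |s^2 - t^2| <= s^2 + |t|^2],
   which is below [(1 + s)^2] as soon as [s] is large: then
   [1 + t = (1 + s) (1 - (s - t) / (1 + s))] is inverted by a Neumann series. *)
Lemma right_invertible_1D_skew t : star t = - t -> exists y, (1 + t) * y = 1.
Proof.
move=> tN; pose s := `|t| ^+ 2.
have s0 : 0 <= s by apply: exprn_ge0.
have s1 : 0 < 1 + s by rewrite ltr_wpDr.
have s1u : 1 + s != 0 by rewrite gt_eqF.
have st : `|s%:A - t| < 1 + s.
  suff : `|s%:A - t| ^+ 2 < (1 + s) ^+ 2 by rewrite ltr_pXn2r// nnegrE // ltW.
  rewrite -norm_starM.
  rewrite starB starZ star1 tN opprK geC0_conj//.
  have -> : (s%:A + t) * (s%:A - t) = (s ^+ 2)%:A - t * t.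
    rewrite mulrDl !mulrBr -scalerAl mul1r scalerA -expr2 -scalerAl mul1r.
    by rewrite -scalerAr mulr1 addrA subrK.
  apply: le_lt_trans (ler_normB _ _) _.
  rewrite normrZ cstar_norm1 mulr1 ger0_norm ?exprn_ge0//.
  apply: le_lt_trans (lerD (lexx _) (cstar_norm_mul_le _ _)) _.
  rewrite -expr2 -/s sqrrD expr1n mul1r [ltRHS]addrC ltrD2l.
  by rewrite mulr2n addrA ltrDr.
have [|y yE] := right_invertible_1B ((1 + s)^-1 *: (s%:A - t)).
  by rewrite normrZ ger0_norm ?invr_ge0 ?ltW// ltr_pdivrMl// mulr1.
exists ((1 + s)^-1 *: y); rewrite -scalerAr scalerAl -[RHS]yE; congr (_ * _).
have -> : 1 + t = (1 + s)%:A - (s%:A - t).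
  by rewrite scalerDl scale1r opprB addrCA addrK addrC.
by rewrite scalerBr scalerA mulVf// scale1r.
Qed.

(* The projection is [e (1 + e - e* )^-1], the range projection of [e]. *)
Lemma idempotent_range_projection e : e * e = e ->
  exists2 n, star (e * n) = e * n & e * n * e = e.
Proof.
move=> ee.
have [|n nE] := right_invertible_1D_skew (e - star e).
  by rewrite starB starK opprB.
(* The involution turns the right inverse [n] of [1 + e - star e] into a left inverse of
   [1 + star e - e], which maps [e] to [star e * e]. *)
have Nn : star n * (1 + star e - e) = 1.
  by rewrite -[RHS]star1 -[in RHS]nE starM !starD star1 starN starK addrA.
have enE : star n * star e * e = e.
  rewrite -mulrA -[RHS]mul1r -Nn -mulrA; congr (_ * _).
  by rewrite mulrBl mulrDl mul1r ee addrAC subrr add0r.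
(* Since [star e * (1 + e - star e) = star e * e], inserting [(1 + e - star e) * n = 1] after
   [star n * star e] yields [star n * star e * e * n = e * n]. *)
have en : star (e * n) = e * n.
  rewrite starM -[star e]mulr1 -nE -[in RHS]enE -!mulrA; congr (_ * _).
  have see : star e * star e = star e by rewrite -starM ee.
  by rewrite !mulrA mulrDr mulr1 mulrBr see addrC subrK.
by exists n; rewrite // -en starM.
Qed.

Lemma left_invertible_diamond_maximal a :
  a \in left_invertible_elements A -> diamond_maximal a.
Proof.
rewrite inE /= => -[c ca] b [aAbA _ abE].
have [x _ axE] : [set b * x | x in [set: A]] a.
  by apply: aAbA; exists 1; rewrite ?mulr1.
have aba : star b * a = star a * a.
  by rewrite -[LHS]mul1r -[RHS]mul1r -ca -!mulrA; congr (_ * _); rewrite !mulrA.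
have ab : star a * b = star a * a.
  by rewrite -[LHS]starK starM starK aba starM starK.
(* [star a * a * (x - 1)] is [star a * b * x - star a * a], which vanishes because [b * x = a]. *)
have x1 : a * (x - 1) = 0.
  apply: star_mul_eq0; rewrite starM -mulrA [star a * _]mulrA mulrBr mulr1.
  by rewrite -{1}ab -[_ * b * x]mulrA axE subrr mulr0.
have : c * (a * (x - 1)) = 0 by rewrite x1 mulr0.
rewrite mulrA ca mul1r => /eqP; rewrite subr_eq0 => /eqP xE.
by rewrite -axE xE mulr1.
Qed.

(** The involution exchanges left and right ideals, so the two inclusions trade places. *)
Lemma diamond_le_star a b : diamond_le a b -> diamond_le (star a) (star b).
Proof.
move=> [aAbA AaAb abE]; split=> [_ [x _ <-]|_ [x _ <-]|].
- have [|y _ yE] := AaAb (star x * a); first by exists (star x).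
  by exists (star y); rewrite // -starM yE starM starK.
- have [|y _ yE] := aAbA (a * star x); first by exists (star x).
  by exists (star y); rewrite // -starM yE starM starK.
- by have := congr1 star abE; rewrite !starM !mulrA.
Qed.

Lemma diamond_maximal_star a : diamond_maximal (star a) -> diamond_maximal a.
Proof.
move=> amax b /diamond_le_star/amax ab.
by rewrite -[a]starK ab starK.
Qed.

Lemma right_invertible_diamond_maximal a :
  a \in right_invertible_elements A -> diamond_maximal a.
Proof.
rewrite inE => -[c ac]; apply/diamond_maximal_star.
apply/left_invertible_diamond_maximal; rewrite inE; exists (star c).
by rewrite -starM ac star1.
Qed.

(* For [b = a + p x q]: [w b = a], [b (c a) = a] and [star b a = star a a]. *)
Lemma maximal_regular_invertible a : prime_algebra A ->
  a \in regular_elements A -> diamond_maximal a ->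
  a \in left_invertible_elements A `|` right_invertible_elements A.
Proof.
move=> primeA; rewrite !inE => -[c aE] amax.
(* [a * c] is idempotent and generates the same right ideal as [a]. *)
have [|n ws we] := idempotent_range_projection (a * c).
  by rewrite mulrA -aE.
set w := a * c * n in ws we.
have wa : w * a = a by move: (congr1 ( *%R^~ a) we); rewrite /= -mulrA -aE.
have ww : w * w = w by rewrite {2}/w mulrA we.
suff /primeA[/eqP|/eqP] : forall x, (1 - w) * x * (1 - c * a) = 0.
- rewrite subr_eq0 => /eqP w1; right; exists (c * n).
  by rewrite mulrA -/w -w1.
- by rewrite subr_eq0 => /eqP ca1; left; exists c; rewrite -ca1.
have aca : a * (c * a) = a by rewrite mulrA -aE.
move=> x; set u := _ * x * _.
have wu : w * u = 0 by rewrite !mulrA [w * (_ - _)]mulrBr mulr1 ww subrr !mul0r.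
have ua : u * (c * a) = 0.
  rewrite /u -mulrA [_ * (c * a)]mulrBl mul1r -[c * a * _]mulrA aca subrr.
  by rewrite mulr0.
(* As [w] is self-adjoint and fixes [a], [star u * a = star (w * u) * a]. *)
have usa : star u * a = 0.
  by rewrite -wa -ws mulrA -starM wu star0 mul0r.
have : a = a + u.
  apply: amax; split=> [_ [y _ <-]|_ [y _ <-]|].
  - by exists (c * a * y); rewrite // mulrA mulrDl ua addr0 aca.
  - by exists (y * w); rewrite // -mulrA mulrDr wu addr0 wa.
  - by rewrite starD mulrDr mulrDl -[a * star u * a]mulrA usa mulr0 addr0.
by move/eqP; rewrite -[X in X == _]addr0 (inj_eq (addrI _)) eq_sym => /eqP.
Qed.

End CStarFacts.

Theorem proposition2p5 (R : realType) (A : cstarAlgType R)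
    (primeA : prime_algebra A) (a : A) :
  (a \in regular_elements A /\ diamond_maximal a) <->
  a \in left_invertible_elements A `|` right_invertible_elements A.
Proof.
split=> [[]|]; first exact: maximal_regular_invertible.
rewrite in_setU => /orP[al|ar]; split.
- by move: al; rewrite !inE => -[c ca]; exists c; rewrite -mulrA ca mulr1.
- exact: left_invertible_diamond_maximal.
- by move: ar; rewrite !inE => -[c ac]; exists c; rewrite ac mul1r.
- exact: right_invertible_diamond_maximal.
Qed.
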